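(* Let $q$ be a prime power. Every idempotent monomial clone on $\mathbb{F}_q$ is singly generated, i.e. it is of the form $\langle\{m\}\rangle$ for a single monomial $m$.
   Context: $\mathbb{N}=\{1,2,\dots\}$, $\mathbb{N}_0=\mathbb{N}\cup\{0\}$, $\mathbb{F}_q$ is the field with $q$ elements. A monomial is a formal product $g=\prod_{i\in\mathbb{N}}x_i^{\alpha(i)}$ with $\alpha(i)\in\mathbb{N}_0$, finitely many but at least one $\alpha(i)$ nonzero (so $1$ is not a monomial); $\mathrm{mI}(g)$ is the largest $i$ with $\alpha(i)\neq0$, called the arity of $g$. For $n\ge\mathrm{mI}(g)$ the $n$-ary induced function is $g^{\mathbb{F}_q^n}\colon\mathbb{F}_q^n\to\mathbb{F}_q$, $(x_1,\dots,x_n)\mapsto\prod_{i=1}^nx_i^{\alpha(i)}$. Monomials $m_1,m_2$ are equivalent if the $\mathrm{mI}(m_1)$-ary induced function of $m_1$ equals the $\mathrm{mI}(m_2)$-ary induced function of $m_2$ (i.e. for each $i$ the exponents of $x_i$ in $m_1$ and $m_2$ are equal, or both positive and congruent modulo $q-1$). A clone on a set $A$ is a set of finitary operations on $A$ (of arities $\ge1$) containing all projections and closed under composition. A set $M$ of monomials is a monomial clone on $\mathbb{F}_q$ if $\{m^{\mathbb{F}_q^n}\mid m\in M,\ n\ge\mathrm{mI}(m)\}$ is a clone on $\mathbb{F}_q$ and $M$ is closed under equivalent monomials. For a set $M'$ of monomials, $\langle M'\rangle$ is the least monomial clone on $\mathbb{F}_q$ containing $M'$. A monomial $g$ is idempotent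 (over $\mathbb{F}_q$) if its induced function satisfies $g^{\mathbb{F}_q^n}(x,\dots,x)=x$ for all $x\in\mathbb{F}_q$, equivalently if the sum of its exponents is congruent to $1$ modulo $q-1$. A monomial clone is idempotent if all its monomials are idempotent. *)

(* Defs.v *)
From HB Require Import structures.
From mathcomp Require Import all_boot all_algebra finmap.
From mathcomp.multinomials Require Import monalg.

Set Implicit Arguments.
Unset Strict Implicit.
Unset Printing Implicit Defensive.

Import GRing.Theory.
Local Open Scope ring_scope.

(** * Clones on a finite set *)

(** [A] is finite, so Leibniz equality of finite functions is equality of
    operations. *)
Definition operation (A : finType) (n : nat) : Type :=
  {ffun {ffun 'I_n -> A} -> A}.

Definition projection (A : finType) (n : nat) (i : 'I_n) : operation A n :=
  [ffun x : {ffun 'I_n -> A} => x i].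

Definition compose (A : finType) (k n : nat)
    (f : operation A k) (g : 'I_k -> operation A n) : operation A n :=
  [ffun x => f [ffun j => g j x]].

(** A set of finitary operations is given by its [n]-ary parts; the first field
    excludes nullary operations. *)
Record is_clone (A : finType) (C : forall n, operation A n -> Prop) : Prop :=
  IsClone {
    clone_arity_gt0 : forall n (f : operation A n), C n f -> (0 < n)%N;
    clone_projection : forall n (i : 'I_n), C n (projection A i);
    clone_compose :
      forall k n (f : operation A k) (g : 'I_k -> operation A n),
        C k f -> (forall j, C n (g j)) -> C n (compose f g)
  }.

(** * Monomials *)

(** Variables are numbered from 0: index [i] stands for the variable
    x_(i+1).  Elements of [{cmonom nat}] are the finitely supported exponent
    functions [nat -> nat]; the empty product is excluded. *)
Record monomial := Monomial {
  monomial_val :> {cmonom nat};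
  _ : monomial_val != mone
}.

(** The largest 1-based index of a variable occurring in [g]. *)
Definition mI (g : monomial) : nat := (\max_(i <- finsupp g) i.+1)%N.

(** Meaningful for [mI g <= n]; for smaller [n] it drops variables of [g]. *)
Definition induced (F : finFieldType) (g : monomial) (n : nat) :
    operation F n :=
  [ffun x : {ffun 'I_n -> F} => \prod_(i < n) x i ^+ g i].

(** Equality in the sum over all arities of the types of [n]-ary operations: the
    arities agree and so do the operations. *)
Definition equivalent (F : finFieldType) (m1 m2 : monomial) : Prop :=
  Tagged (operation F) (induced F m1 (mI m1)) =
  Tagged (operation F) (induced F m2 (mI m2)).

(** * Monomial clones *)

Definition induced_operations (F : finFieldType) (M : monomial -> Prop)
    (n : nat) (f : operation F n) : Prop :=
  exists m, [/\ M m, (mI m <= n)%N & f = induced F m n].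

Definition is_monomial_clone (F : finFieldType) (M : monomial -> Prop) : Prop :=
  is_clone (@induced_operations F M) /\
  (forall m1 m2, equivalent F m1 m2 -> M m1 -> M m2).

(** [M] is the least monomial clone on [F] containing the generating set [M']. *)
Definition generates (F : finFieldType) (M' M : monomial -> Prop) : Prop :=
  [/\ is_monomial_clone F M,
      forall m, M' m -> M m
    & forall N : monomial -> Prop, is_monomial_clone F N ->
        (forall m, M' m -> N m) -> forall m, M m -> N m].

Definition idempotent_monomial (F : finFieldType) (g : monomial) : Prop :=
  forall n, (mI g <= n)%N -> forall x : F, induced F g n [ffun=> x] = x.

Definition idempotent_clone (F : finFieldType) (M : monomial -> Prop) : Prop :=
  forall m, M m -> idempotent_monomial F m.

(* Main.v *)
Require Import Defs.
From mathcomp Require Import all_boot all_algebra.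
From mathcomp Require Import finfield finmap.
From mathcomp.multinomials Require Import monalg.
From Stdlib Require Import Classical.

Set Implicit Arguments.
Unset Strict Implicit.
Unset Printing Implicit Defensive.

Import GRing.Theory.
Local Open Scope ring_scope.

(** An idempotent monomial clone turns out to be finitely generated, and finitely
    many idempotent operations can be merged into one.

    Merging: if [f] and [g] are idempotent, then [f(g(..), ..., g(..))] with all
    variables distinct lies in every clone containing both, and identifying
    variables row-wise or column-wise gives back [f] and [g]
    ([idempotent_clone_join]).  Hence the [K]-ary part of an idempotent clone on a
    finite set, being finite, lies in the subclone generated by a single member
    ([idempotent_clone_generator]).

    Finite generation: let [f] be the product of the x_i ^ e_i, a member of the
    clone, with more variables than [support_bound].  By the pigeonhole principle
    [q] of its exponents define the same power function on the field with [q]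
    elements ([many_equal_powers]); choose one of these variables, x_0, and let
    [X] be the other [q - 1].  Two minors of [f] are then simpler than [f].
    - Identifying [X] with x_0 raises x_0 to [q] times its exponent; as z ^ q = z,
      the result [f0] is [f] with the variables of [X] deleted.
    - Identifying everything outside [X] with x_0 gives, by idempotence, the
      operation [g], the product of x_0 ^ 1 and the x_i ^ e_i over [X], because
      the exponents in [X] contribute a [q - 1]-st power.
    Substituting [f0] for x_0 in [g] gives back [f].  By induction on the number
    of variables, the clone is generated by its members with at most
    [support_bound] variables ([power_products_generated]), hence by its part of
    one fixed arity ([small_support_arity]).

    The argument concerns operations; it comes back to monomials because the
    arity of a monomial can be read off its induced operation
    ([induced_eq_arity]). *)

(** * Merging finitely many idempotent operations *)

Definition idempotent_operation (A : finType) n (f : operation A n) : Prop :=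
  forall a : A, f [ffun=> a] = a.

Definition minor (A : finType) k n (v : 'I_k -> 'I_n) (f : operation A k) :
    operation A n :=
  [ffun x : {ffun 'I_n -> A} => f [ffun j => x (v j)]].

Lemma clone_minor (A : finType) (C : forall n, operation A n -> Prop)
    k n (v : 'I_k -> 'I_n) (f : operation A k) :
  is_clone C -> C k f -> C n (minor v f).
Proof.
move=> cC Cf.
have -> : minor v f = compose f (fun j => projection A (v j)).
  apply/ffunP=> x; rewrite !ffunE; congr (f _).
  by apply/ffunP=> j; rewrite !ffunE.
by apply: clone_compose => // j; apply: clone_projection.
Qed.

(** The operation [h] is [f] applied to [k] copies of [g] in pairwise distinct
    variables, indexed by the pairs [(i, j)].  Making the variables of each copy
    equal collapses every [g] by its idempotence; making the copies equal
    collapses [f]. *)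
Lemma idempotent_clone_join (A : finType) (C : forall n, operation A n -> Prop)
    k l (f : operation A k) (g : operation A l) :
  is_clone C -> C k f -> C l g ->
  idempotent_operation f -> idempotent_operation g ->
  exists n (h : operation A n), C n h /\
    forall D : forall n, operation A n -> Prop,
      is_clone D -> D n h -> D k f /\ D l g.
Proof.
move=> cC Cf Cg idf idg.
pose rk (i : 'I_k) (j : 'I_l) := enum_rank (i, j).
exists _, (compose f (fun i => minor (rk i) g)); split.
  by apply: clone_compose => // i; apply: clone_minor.
move=> D cD Dh; split.
- have := clone_minor (fun p => (enum_val p).1) cD Dh.
  congr D; apply/ffunP=> x; rewrite !ffunE; congr (f _).
  apply/ffunP=> i; rewrite !ffunE -[RHS](idg (x i)); congr (g _).
  by apply/ffunP=> j; rewrite !ffunE enum_rankK.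
- have := clone_minor (fun p => (enum_val p).2) cD Dh.
  congr D; apply/ffunP=> x; rewrite !ffunE -[RHS](idf (g x)); congr (f _).
  apply/ffunP=> i; rewrite !ffunE; congr (g _).
  by apply/ffunP=> j; rewrite !ffunE enum_rankK.
Qed.

(** Finitely many joins suffice, since there are finitely many [K]-ary operations;
    [h] itself usually has a much larger arity.  Membership in [C] is an arbitrary
    proposition, so selecting the members of [C] is a classical step. *)
Lemma idempotent_clone_generator (A : finType)
    (C : forall n, operation A n -> Prop) K :
  is_clone C -> (forall n (f : operation A n), C n f -> idempotent_operation f) ->
  exists n (h : operation A n), C n h /\
    forall D : forall n, operation A n -> Prop,
      is_clone D -> D n h -> forall f, C K f -> D K f.
Proof.
move=> cC idC.
suff [n [h [Ch hP]]] : exists n (h : operation A n), C n h /\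
    forall D : forall n, operation A n -> Prop, is_clone D -> D n h ->
      forall f, f \in enum {: {ffun {ffun 'I_K -> A} -> A}} -> C K f -> D K f.
  exists n, h; split=> // D cD Dh f.
  by apply: hP; rewrite // mem_enum.
elim: (enum _) => [|f s [n [h [Ch hP]]]].
  by exists 1, (projection A ord0); split; first exact: clone_projection.
have [Cf|nCf] := classic (C K f); last first.
  exists n, h; split=> // D cD Dh g.
  by rewrite inE => /predU1P[-> //|]; apply: hP.
have [n' [h' [Ch' h'P]]] :=
  idempotent_clone_join cC Cf Ch (idC _ _ Cf) (idC _ _ Ch).
exists n', h'; split=> // D cD /(h'P D cD)[Df Dh] g.
by rewrite inE => /predU1P[-> //|]; apply: hP.
Qed.

(** * Reduction to boundedly many variables *)

Section PowerProducts.
Variable F : finFieldType.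

Definition power_product n (e : 'I_n -> nat) : operation F n :=
  [ffun x : {ffun 'I_n -> F} => \prod_(i < n) x i ^+ e i].

Definition support_size n (e : 'I_n -> nat) : nat := #|[set i | 0 < e i]|%N.

(** Pigeonholes are the functions [F -> F], a crude bound on the number of power
    functions; each has room for [#|F|] variables. *)
Definition support_bound : nat := (#|F| * #|{ffun F -> F}|)%N.

(** Exponents are compared through their power functions on [F], which avoids
    congruences modulo [#|F| - 1].  The size of [X] serves two purposes: with [i0]
    it makes [#|F|] variables, whose powers multiply to a [#|F|]-th power, and
    without [i0] those powers multiply to a [(#|F| - 1)]-st power. *)
Lemma many_equal_powers n (e : 'I_n -> nat) :
  (support_bound < support_size e)%N ->
  exists (i0 : 'I_n) (X : {set 'I_n}),
    [/\ (0 < e i0)%N, i0 \notin X, #|X|.+1 = #|F| &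
        forall i, i \in X -> (0 < e i)%N /\ forall x : F, x ^+ e i = x ^+ e i0].
Proof.
move=> big; pose S := [set i | 0 < e i]%N.
pose pw i : {ffun F -> F} := [ffun x => x ^+ e i].
have [w ltqw] : exists w, (#|F| < #|[set i in S | pw i == w]|)%N.
  apply/existsP; move: big; apply: contraLR; rewrite negb_exists -leqNgt.
  move=> /forallP small; rewrite /support_bound -/S.
  have -> : support_size e = (\sum_w #|[set i in S | pw i == w]|)%N.
    rewrite /support_size -/S -sum1_card (partition_big pw xpredT) //=.
    apply: eq_bigr => w _; rewrite -sum1_card; apply: eq_bigl => i.
    by rewrite inE.
  rewrite mulnC -sum_nat_const; apply: leq_sum => w _.
  by rewrite leqNgt; apply: small.
set T := [set i in S | _] in ltqw.
have /card_gt0P[i0 Ti0] : (0 < #|T|)%N by apply: leq_trans ltqw.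
have /card_geqP[s [us szs sT]] : (#|F|.-1 <= #|T :\ i0|)%N.
  by move: ltqw; rewrite (cardsD1 i0) Ti0 ltnS; apply/leq_trans/leq_pred.
exists i0, [set i in s].
have inT i : i \in T -> (0 < e i)%N /\ pw i = w.
  by rewrite !inE => /andP[? /eqP].
have [e_gt0 pw0] := inT i0 Ti0; split=> // [||i].
- by apply/negP; rewrite inE => /sT; rewrite !inE eqxx.
- by rewrite cardsE (card_uniqP us) szs prednK // ltnW // finNzRing_gt1.
- rewrite inE => /sT/setD1P[_ /inT[ei_gt0 pwi]]; split=> // x.
  by move: pwi; rewrite -pw0 => /ffunP/(_ x); rewrite !ffunE.
Qed.

(** Any product [f] with too many variables is [g(f0, ...)] for two of its minors
    [f0] and [g] with fewer variables, so [D] contains it as soon as it contains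
    the products with few variables. *)
Lemma power_products_generated n (C D : forall n, operation F n -> Prop) :
  is_clone C -> is_clone D ->
  (forall f, C n f -> idempotent_operation f) ->
  (forall e : 'I_n -> nat, (support_size e <= support_bound)%N ->
     C n (power_product e) -> D n (power_product e)) ->
  forall e : 'I_n -> nat, C n (power_product e) -> D n (power_product e).
Proof.
move=> cC cD idC small e.
have [k] := ubnP (support_size e); elim: k e => // k IHk e.
rewrite ltnS => le_e_k Cf.
have [|big] := leqP (support_size e) support_bound; first by move/small; apply.
have [i0 [X [e0_gt0 X'i0 cX eX]]] := many_equal_powers big.
have prodX (y : F) : \prod_(i in X) y ^+ e i = (y ^+ e i0) ^+ #|X|.
  by rewrite -prodr_const; apply: eq_bigr => i /eX[_].
have expX (z : F) : z ^+ #|X| * z = z by rewrite -exprSr cX expf_card.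
(* Idempotence of [f] in [y] splits off the factor [(y ^+ e i0) ^+ (#|F| - 1)],
   which is 1 unless [y = 0]; in that case the factor of [i0] vanishes. *)
have prodX' (y : F) : \prod_(i | i \notin X) y ^+ e i = y.
  have := idC _ Cf y; rewrite ffunE (bigID (mem X)) /=.
  under eq_bigr do rewrite ffunE.
  under [X in _ * X]eq_bigr do rewrite ffunE.
  rewrite prodX; have [-> _|y0] := eqVneq y 0.
    by rewrite (bigD1 i0) //= expr0n gtn_eqF ?mul0r.
  suff -> : (y ^+ e i0) ^+ #|X| = 1 by rewrite mul1r.
  by apply: (mulIf (expf_neq0 (e i0) y0)); rewrite expX mul1r.
have /card_gt0P[i1 Xi1] : (0 < #|X|)%N by rewrite -ltnS cX finNzRing_gt1.
(* [f0]: the variables of [X] are identified with [i0], whose total exponent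
   becomes [#|F|] times [e i0]. *)
pose ef0 i := (if i \in X then 0 else e i)%N.
have Df0 : D n (power_product ef0).
  apply: IHk.
    apply: leq_trans le_e_k; apply: proper_card.
    apply/properP; split.
      by apply/subsetP => i; rewrite !inE /ef0; case: ifP.
    by exists i1; rewrite !inE /ef0 ?Xi1 //; case: (eX _ Xi1).
  have := clone_minor (fun i => if i \in X then i0 else i) cC Cf.
  congr C; apply/ffunP=> x; rewrite !ffunE /ef0.
  rewrite !(bigID (mem X) xpredT) /=.
  under eq_bigr => i Xi do rewrite ffunE Xi.
  rewrite prodX [X in _ = X * _]big1 ?mul1r => [|i ->]; last by rewrite expr0.
  rewrite !(bigD1 (P := fun i => i \notin X) i0) //= ffunE.
  rewrite (negPf X'i0) mulrA expX.
  by congr (_ * _); apply: eq_bigr => i /andP[/negPf X'i _]; rewrite ffunE X'i.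
(* [g]: all variables outside [X] are identified with [i0], whose total exponent
   acts as 1 by [prodX']. *)
pose eg i := if i \in X then e i else (i == i0).
have Dg : D n (power_product eg).
  apply: IHk.
    apply: leq_trans le_e_k; apply: leq_ltn_trans big.
    have : (support_size eg <= #|i0 |: X|)%N.
      apply: subset_leq_card; apply/subsetP => i; rewrite !inE /eg.
      by case: ifP => [_|_]; rewrite ?orbT // orbF lt0b.
    rewrite cardsU1 X'i0 add1n cX => /leq_trans; apply.
    by rewrite leq_pmulr //; apply/card_gt0P; exists [ffun=> 0].
  have := clone_minor (fun i => if i \in X then i else i0) cC Cf.
  congr C; apply/ffunP=> x; rewrite !ffunE.
  rewrite !(bigID (mem X) xpredT) /=; congr (_ * _).
    by apply: eq_bigr => i Xi; rewrite ffunE /eg Xi.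
  under eq_bigr => i /negPf X'i do rewrite ffunE X'i.
  rewrite prodX' (bigD1 i0) //= /eg (negPf X'i0) eqxx expr1.
  rewrite big1 ?mulr1 // => i /andP[/negPf-> /negPf->]; exact: expr0.
pose sub i := if i == i0 then power_product ef0 else projection F i.
have : D n (compose (power_product eg) sub).
  apply: clone_compose => // i; rewrite /sub; case: ifP => // _.
  exact: clone_projection.
congr D; apply/ffunP=> x.
rewrite !ffunE !(bigID (mem X) xpredT) /=; congr (_ * _).
  apply: eq_bigr => i Xi; rewrite ffunE /sub /eg Xi ifN ?ffunE //.
  by apply: contraNneq X'i0 => <-.
rewrite (bigD1 i0) //= /eg (negPf X'i0) eqxx expr1 ffunE /sub eqxx ffunE.
rewrite [X in _ * X]big1 => [|i /andP[/negPf-> /negPf->]]; last exact: expr0.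
rewrite mulr1 (bigID (mem X)) /= /ef0.
rewrite big1 ?mul1r => [|i ->]; last exact: expr0.
by apply: eq_bigr => i /negPf->.
Qed.

(** A product depending on at most [K.+1] variables is, up to renaming them, of
    arity [K.+1].  The renamings [r] and [t] are inverse to each other only on the
    variables with a positive exponent, which is enough because the other factors
    are 1. *)
Lemma small_support_arity n (e : 'I_n -> nat) K
    (C D : forall n, operation F n -> Prop) :
  is_clone C -> is_clone D -> (support_size e <= K.+1)%N ->
  (forall f, C K.+1 f -> D K.+1 f) ->
  C n (power_product e) -> D n (power_product e).
Proof.
move=> cC cD leK CD Cf; have n_gt0 := clone_arity_gt0 cC Cf.
pose s := enum [set i | 0 < e i]%N.
pose r i : 'I_K.+1 := inord (index i s).
pose t (j : 'I_K.+1) := nth (Ordinal n_gt0) s j.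
have := clone_minor t cD (CD _ (clone_minor r cC Cf)).
congr D; apply/ffunP=> x; rewrite !ffunE; apply: eq_bigr => i _; rewrite !ffunE.
have [->|e_gt0] := posnP (e i); first by rewrite !expr0.
have si : i \in s by rewrite mem_enum inE.
rewrite /t inordK ?nth_index //; apply: leq_trans leK.
by rewrite /support_size cardE index_mem.
Qed.

End PowerProducts.

(** * From operations back to monomials *)

Section Monomials.
Variable F : finFieldType.

Lemma mem_finsupp_lt_mI (g : monomial) i : i \in finsupp g -> (i < mI g)%N.
Proof. by move=> gi; rewrite /mI (big_fsetD1 i) //= leq_maxl. Qed.

(** An operation induced by [m] depends on every variable of [m]: at the point that
    is 0 in that variable and 1 elsewhere, it vanishes, whereas a monomial without
    this variable takes the value 1. *)
Lemma induced_eq_arity (m m' : monomial) :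
  (mI m' <= mI m)%N -> induced F m (mI m) = induced F m' (mI m) ->
  mI m' = mI m.
Proof.
move=> le_m'm eq_mm'; apply/eqP; rewrite eqn_leq le_m'm.
apply/bigmax_leqP_seq => i mi _.
have lt_i := mem_finsupp_lt_mI mi.
apply: mem_finsupp_lt_mI; apply/negPn/negP => m'i.
have /ffunP/(_ [ffun j => (j != Ordinal lt_i)%:R]) := eq_mm'.
rewrite !ffunE (bigD1 (Ordinal lt_i)) //= ffunE eqxx expr0n.
move: mi; rewrite mem_finsupp => /negPf->; rewrite mul0r.
rewrite big1 => [/esym/eqP|j _]; first by rewrite oner_eq0.
rewrite ffunE; have [->|_] := eqVneq; last exact: expr1n.
by move: m'i; rewrite mem_finsupp negbK => /eqP->.
Qed.

(** A monomial clone is determined by its induced operations.  Its closure under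
    equivalence compares monomials only at their own arities, which is why
    [induced_eq_arity] is needed. *)
Lemma monomial_clone_mem (M : monomial -> Prop) m :
  is_monomial_clone F M ->
  induced_operations M (induced F m (mI m)) -> M m.
Proof.
move=> [_ eqM] [m' [Mm' le_m'm eq_mm']].
apply: eqM Mm'; rewrite /equivalent eq_mm'.
by rewrite (induced_eq_arity le_m'm eq_mm').
Qed.

End Monomials.

Theorem corollary7p4 (F : finFieldType) (M : monomial -> Prop) :
  is_monomial_clone F M ->
  idempotent_clone F M ->
  exists m : monomial, generates F (fun g => g = m) M.
Proof.
move=> mM idM; have [cM _] := mM.
have idC n (f : operation F n) :
    induced_operations M f -> idempotent_operation f.
  by case=> m [Mm le_mn ->] x; apply: idM.
have [n [h [[m [Mm le_mn eq_h]] hP]]] :=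
  idempotent_clone_generator (support_bound F).+1 cM idC.
exists m; split=> [//|_ -> //|N mN Nm m' Mm']; have [cN _] := mN.
apply: (monomial_clone_mem mN).
apply: (power_products_generated cM cN (idC _)); last by exists m'.
move=> e le_e; apply: (small_support_arity cM cN (leqW le_e)).
by apply: (hP _ cN); exists m; split=> //; apply: Nm.
Qed.
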